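(* Let $G$ be a finite commutative group with $|G|=q$ and $3\nmid q$. For $\frac65q^{-1}<\rho<q^{-2/3}$ the random standard set $R$ corresponding to probability $\rho$ satisfies \[ \Pr\bigl(\overline\Delta(R)\le 2\bigr)>1-q^2\rho^3. \]
   Context: $G$ is written additively. A set $A\subset G$ is a standard set if $A=-A$ and $0\in A$; for such $A$, $\overline\Delta(A)=\max\{|B|:B\subset G,\ B-B\subset A\}$. Random standard set: let $G_1=\{x\in G:2x=0\}$ and let $G_2$ be a set containing exactly one element of each pair $\{x,-x\}$ partitioning $G\setminus G_1$. Let $\{\xi_y:y\in G_1\cup G_2\}$ be independent $\{0,1\}$-valued random variables with $\Pr(\xi_y=1)=\rho$. The random standard set corresponding to probability $\rho$ is $R=\{0\}\cup\{y\in G_1:\xi_y=1\}\cup\bigcup_{y\in G_2,\ \xi_y=1}\{y,-y\}$. *)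

(* Defs.v *)
From mathcomp Require Import all_boot all_algebra.
From mathcomp Require Import all_classical all_reals all_analysis.

Set Implicit Arguments.
Unset Strict Implicit.
Unset Printing Implicit Defensive.

Import GRing.Theory.
Local Open Scope ring_scope.

Section StandardSets.
Variable G : finZmodType.
Implicit Types (A B : {set G}).

Definition diffset B : {set G} := [set (x - y)%R | x in B, y in B]%SET.

Definition standard_set A : bool :=
  ([set (- x)%R | x in A]%SET == A) && (0%R \in A).

(* The maximum ranges over a nonempty family, as [B = set0] always qualifies,
   so the default value 0 of [\max] is harmless. *)
Definition barDelta A : nat :=
  (\max_(B : {set G} | diffset B \subset A) #|B|)%N.

Definition invol_set : {set G} := [set x : G | x *+ 2 == 0]%SET.

Definition half_set (G2 : {set G}) : Prop :=
  (G2 \subset ~: invol_set)%SET /\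
  (forall x : G, x \notin invol_set -> (x \in G2) (+) (- x \in G2)).

(* One outcome of the random standard set; [e y] is the value of the 0-1
   variable attached to [y], and only its values on [invol_set :|: G2] matter. *)
Definition standard_set_of (G2 : {set G}) (e : G -> bool) : {set G} :=
  (0%R |: [set y in invol_set | e y]
       :|: \bigcup_(y in G2 | e y) [set y; - y])%SET.

Lemma standard_set_ofP (G2 : {set G}) (e : G -> bool) :
  standard_set (standard_set_of G2 e).
Proof.
have memN z : z \in standard_set_of G2 e -> - z \in standard_set_of G2 e.
  rewrite /standard_set_of !inE => /orP[/orP[/eqP->|/andP[z2 ez]]|].
  - by rewrite oppr0 eqxx.
  - have -> : - z = z by apply/eqP; rewrite eq_sym -subr_eq0 opprK -mulr2n.
    by rewrite z2 ez orbT.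
  - case/finset.bigcupP=> y yG; rewrite !inE => /orP[] /eqP->;
      (apply/orP; right; apply/finset.bigcupP; exists y => //);
      by rewrite !inE ?opprK eqxx ?orbT.
apply/andP; split; last by rewrite /standard_set_of !inE eqxx.
apply/eqP/setP => z; apply/imsetP/idP => [[x xS ->]|zS]; first exact: memN.
by exists (- z); rewrite ?opprK //; apply: memN.
Qed.

End StandardSets.

Definition independent_RVs (d d' : measure_display) (T : measurableType d)
    (T' : measurableType d') (R : realType) (P : probability T R)
    (I : finType) (D : {set I}) (X : I -> {RV P >-> T'}) : Prop :=
  forall (J : {set I}) (A : I -> set T'),
    J \subset D ->
    (forall i, i \in J -> measurable (A i)) ->
    P [set t | forall i, i \in J -> A i (X i t)]%classic
    = (\prod_(i in J) P (X i @^-1` A i)%classic)%E.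

(* Main.v *)
Require Import Defs.
From mathcomp Require Import all_boot all_algebra.
From mathcomp Require Import all_classical all_reals all_analysis.
From mathcomp Require Import all_order cyclic zify lra.

Import Order.TTheory GRing.Theory Num.Theory.
Local Open Scope ring_scope.

(** If [B - B] lies in [R] and [B] has three elements [x, y, z], then [R] contains
    the nonzero elements [u = x - y], [v = y - z] and [u + v].  Up to sign these are
    either three different elements, or (since [3] does not divide [q]) exactly two,
    namely [x] and [2x] for some [x] with [2x <> 0].  There are at most [q^2 / 2]
    configurations of the first kind, each of probability [rho^3], and at most [q / 2]
    of the second kind, each of probability [rho^2].  As [rho > 6 / (5 q)], the union
    bound gives less than [(1/2 + 5/12) q^2 rho^3]. *)

(** Lagrange gives [#|G| x = 0]; reducing [#|G|] modulo 3 leaves [x = 0] or [2x = 0], and the latter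
    with [3x = 0] again forces [x = 0]. *)
Lemma mulr3n_eq0 {G : finZmodType} {x : G} :
  ~~ (3 %| #|G|)%N -> x *+ 3 = 0 -> x = 0.
Proof.
move=> h3 x3.
have : x *+ #|G| = 0.
  rewrite -FinRing.zmodXgE -cardsT.
  exact: (@expg_cardG (FinRing.Zmodule_to_finGroup G) (fingroup.setT_group _) x (finset.in_setT x)).
rewrite (divn_eq #|G| 3) mulrnDr mulnC mulrnA x3 mul0rn add0r.
have := ltn_mod #|G| 3; move: h3; rewrite /dvdn.
case: (#|G| %% 3)%N => [|[|[|]]] //= _ _ x2.
by move: x3; rewrite mulrSr x2 add0r.
Qed.

Lemma leq_card_imset_filter (T U : finType) (f : T -> U) (A : {set T}) (Q : pred U) :
  (#|[set y in [set f x | x in A] | Q y]%SET| <= #|A|)%N.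
Proof.
apply: leq_trans (leq_imset_card f A); apply: subset_leq_card.
by apply/fintype.subsetP => y; rewrite inE => /andP[].
Qed.

(** * Representatives of the pairs {x, -x} *)

(** For a valid half set [G2], this is the index of the variable that decides whether a nonzero [x]
    belongs to the random set. *)
Definition pm_rep {G : finZmodType} (G2 : {set G}) (x : G) : G :=
  if x \in (invol_set G :|: G2)%SET then x else - x.

Section PmRep.

Context {G : finZmodType} {G2 : {set G}} (hG2 : half_set G2).

Lemma opp_invol (x : G) : x \in invol_set G -> - x = x.
Proof.
by rewrite inE mulr2n addr_eq0 => /eqP {2}->.
Qed.

Lemma pm_rep_in (x : G) : pm_rep G2 x \in (invol_set G :|: G2)%SET.
Proof.
rewrite /pm_rep; case: ifPn => //; rewrite finset.in_setU negb_or => /andP[x1 x2].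
by have := hG2.2 x x1; rewrite finset.in_setU (negbTE x2) /= => ->; rewrite orbT.
Qed.

Lemma pm_repN (x : G) : pm_rep G2 (- x) = pm_rep G2 x.
Proof.
have [x1|x1] := boolP (x \in invol_set G); first by rewrite opp_invol.
have x1' : - x \notin invol_set G.
  by apply: contra x1 => /[dup] /opp_invol; rewrite opprK => {2}->.
rewrite /pm_rep !finset.in_setU (negbTE x1) (negbTE x1') /= opprK.
by have := hG2.2 x x1; case: (x \in G2); case: (- x \in G2).
Qed.

Lemma pm_rep_cases (x : G) : pm_rep G2 x = x \/ pm_rep G2 x = - x.
Proof. by rewrite /pm_rep; case: ifP; [left | right]. Qed.

Lemma pm_rep_eq (x y : G) : pm_rep G2 x = pm_rep G2 y -> x = y \/ x = - y.
Proof.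
case: (pm_rep_cases x) => ->; case: (pm_rep_cases y) => -> E.
- by left.
- by right.
- by right; rewrite -E opprK.
- by left; apply: oppr_inj.
Qed.

(** Zero is excluded because it lies in the set whatever the value of [e 0]. *)
Lemma pm_rep_mem (e : G -> bool) (x : G) :
  x \in standard_set_of G2 e -> x != 0 -> e (pm_rep G2 x).
Proof.
rewrite /standard_set_of !finset.in_setU finset.in_set1 => /orP[/orP[->//|]|].
  by rewrite inE => /andP[x1 ex] _; rewrite /pm_rep finset.in_setU x1.
case/finset.bigcupP => y /andP[yG ey] + _.
have yr : pm_rep G2 y = y by rewrite /pm_rep finset.in_setU yG orbT.
by rewrite !inE => /orP[] /eqP ->; rewrite ?pm_repN yr.
Qed.

(** * Counting the possible supports *)

Lemma card_half_set : (#|G2| * 2 <= #|G|)%N.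
Proof.
have dis : [disjoint G2 & [set - x | x in G2]%SET].
  rewrite finset.disjoints_subset; apply/fintype.subsetP => x xG.
  rewrite inE; apply/imsetP => -[y yG xy].
  have y1 : y \notin invol_set G.
    by have /fintype.subsetP/(_ _ yG) := hG2.1; rewrite inE.
  by have := hG2.2 y y1; rewrite yG -xy xG.
(* Disjointness is the equality case of the bound on the size of a union, so [G2] and its negative
   together have exactly [2 * #|G2|] elements. *)
have /eqP := etrans (leq_card_setU G2 [set - x | x in G2]%SET).2 dis.
rewrite (card_imset _ oppr_inj) muln2 -addnn => <-.
exact: max_card.
Qed.

(** Letting [x] run over [G2] only, not over [G], gives the count [q / 2]; the filter on [#|J|]
    makes the probability of each support exactly [rho ^+ 2]. *)
Definition double_supports : {set {set G}} :=
  [set J in [set [set x; pm_rep G2 (x *+ 2)] | x in G2] | #|J| == 2]%SET.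

(** For [B = {u, v}] the sum over [B] is [u + v]. Indexing by unordered pairs bounds the count by a
    binomial coefficient, which saves the factor 2. *)
Definition triple_supports : {set {set G}} :=
  [set J in [set [set pm_rep G2 x | x in (\sum_(y in B) y)%R |: B]
                | B : {set G} in [set B : {set G} | #|B| == 2]] | #|J| == 3]%SET.

Lemma card_double_supports : (#|double_supports| * 2 <= #|G|)%N.
Proof.
by apply: leq_trans card_half_set; rewrite leq_mul2r leq_card_imset_filter orbT.
Qed.

Lemma card_triple_supports : (#|triple_supports| * 2 <= #|G| ^ 2)%N.
Proof.
have : (#|triple_supports| <= 'C(#|G|, 2))%N.
  by rewrite -card_draws leq_card_imset_filter.
rewrite bin2; nia.
Qed.

Lemma supports_sub (J : {set G}) :
  J \in (double_supports :|: triple_supports)%SET -> J \subset (invol_set G :|: G2)%SET.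
Proof.
rewrite finset.in_setU !inE => /orP[] /andP[] /imsetP[] A AP -> _; apply/fintype.subsetP => y.
- rewrite finset.in_set2 => /orP[] /eqP ->; last exact: pm_rep_in.
  by rewrite finset.in_setU AP orbT.
- by move=> /imsetP[x _ ->]; apply: pm_rep_in.
Qed.

(** * From a large difference set to a support *)

Context (h3 : ~~ (3 %| #|G|)%N) (e : G -> bool).


Lemma double_support_witness (u : G) :
    u *+ 2 != 0 -> e (pm_rep G2 u) -> e (pm_rep G2 (u *+ 2)) ->
  exists2 J, J \in double_supports & {in J, forall i, e i}.
Proof.
move=> u2 e1 e2.
(* Since [u] may lie outside [G2], the witness is built from its representative; this changes [2u]
   at most by a sign. *)
have r2 : pm_rep G2 (pm_rep G2 u *+ 2) = pm_rep G2 (u *+ 2).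
  by case: (pm_rep_cases u) => -> //; rewrite mulNrn pm_repN.
have u0 : u != 0 by apply: contraNneq u2 => ->; rewrite mul0rn.
have rG : pm_rep G2 u \in G2.
  have := pm_rep_in u; rewrite finset.in_setU => /orP[] //.
  by rewrite inE; case: (pm_rep_cases u) => ->; rewrite ?mulNrn ?oppr_eq0 (negbTE u2).
exists [set pm_rep G2 u; pm_rep G2 (u *+ 2)]%SET; last first.
  by move=> i; rewrite !inE => /orP[] /eqP ->.
rewrite inE; apply/andP; split.
  by apply/imsetP; exists (pm_rep G2 u); rewrite // r2.
(* Equal representatives would mean [u = 2u], so [u = 0], or [u = - 2u], so [3u = 0], which is
   excluded as 3 does not divide the order. *)
rewrite cards2 eqSS eqb1; apply/eqP => /pm_rep_eq [/eqP|/eqP].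
  by rewrite mulr2n -subr_eq0 opprD addNKr oppr_eq0 (negbTE u0).
by rewrite -addr_eq0 -mulrS => /eqP /(mulr3n_eq0 h3) /eqP; rewrite (negbTE u0).
Qed.

(** If the three representatives are distinct they form a triple support. Any coincidence either
    contradicts one of the nonvanishing hypotheses or makes one element, up to sign, the double of
    another. *)
Lemma support_witness (u v : G) :
    u != 0 -> v != 0 -> u + v != 0 ->
    e (pm_rep G2 u) -> e (pm_rep G2 v) -> e (pm_rep G2 (u + v)) ->
  exists2 J, J \in (double_supports :|: triple_supports)%SET & {in J, forall i, e i}.
Proof.
move=> u0 v0 s0 eu ev es.
have dbl w : w *+ 2 != 0 -> e (pm_rep G2 w) -> e (pm_rep G2 (w *+ 2)) ->
  exists2 J, J \in (double_supports :|: triple_supports)%SET & {in J, forall i, e i}.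
  move=> w0 e1 e2; have [J JD Je] := double_support_witness w w0 e1 e2.
  by exists J; rewrite // finset.in_setU JD.
have [uv|nuv] := eqVneq (pm_rep G2 u) (pm_rep G2 v).
  case: (pm_rep_eq _ _ uv) => [E|E]; last by rewrite E addNr eqxx in s0.
  by apply: (dbl v); rewrite // mulr2n -{1}E.
have [us|nus] := eqVneq (pm_rep G2 u) (pm_rep G2 (u + v)).
  case: (pm_rep_eq _ _ us) => /eqP.
    by rewrite -subr_eq0 opprD addNKr oppr_eq0 (negbTE v0).
  (* Here [u = - (u + v)], that is [2u = - v], so [u] and its double give the support. *)
  rewrite -addr_eq0 addrA -mulr2n addr_eq0 => /eqP E.
  by apply: (dbl u); rewrite // E ?oppr_eq0 // pm_repN.
have [vs|nvs] := eqVneq (pm_rep G2 v) (pm_rep G2 (u + v)).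
  case: (pm_rep_eq _ _ vs) => /eqP.
    by rewrite -subr_eq0 opprD addrCA subrr addr0 oppr_eq0 (negbTE u0).
  rewrite -addr_eq0 addrC -addrA -mulr2n addrC addr_eq0 => /eqP E.
  by apply: (dbl v); rewrite // E ?oppr_eq0 // pm_repN.
(* Distinctness ensures that the sum over the set [{u, v}] has two terms. *)
have nuv' : u != v by apply: contraNneq nuv => ->.
have sB : \sum_(y in [set u; v]%SET) y = u + v.
  by rewrite big_setU1 ?inE //= big_set1.
exists [set pm_rep G2 x | x in (\sum_(y in [set u; v]) y)%R |: [set u; v]]%SET; last first.
  move=> i /imsetP[x]; rewrite sB !inE => xP ->.
  by case/orP: xP => [/eqP ->//|/orP[] /eqP -> //].
rewrite finset.in_setU; apply/orP; right; rewrite inE; apply/andP; split.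
  by apply/imsetP; exists [set u; v]%SET; rewrite // inE cards2 nuv'.
rewrite sB !imsetU1 imset_set1 cardsU1 cards2 !inE.
by rewrite nuv ![pm_rep G2 (u + v) == _]eq_sym (negbTE nus) (negbTE nvs).
Qed.

Lemma barDelta_gt2_support :
    (2 < barDelta (standard_set_of G2 e))%N ->
  exists2 J, J \in (double_supports :|: triple_supports)%SET & {in J, forall i, e i}.
Proof.
rewrite ltnNge => /bigmax_leqP /existsNP[B].
move=> /not_implyP[/fintype.subsetP sB /negP].
rewrite -ltnNge => /card_gt2P[x [y [z [[xB yB zB] [xy yz zx]]]]].
have eB a b : a \in B -> b \in B -> a != b -> e (pm_rep G2 (a - b)).
  move=> aB bB ab; apply: pm_rep_mem; last by rewrite subr_eq0.
  by apply: sB; apply/imset2P; exists a b.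
have E : x - y + (y - z) = x - z by rewrite addrA subrK.
by apply: (@support_witness (x - y) (y - z)); rewrite ?E ?subr_eq0 ?eB // eq_sym.
Qed.

End PmRep.

Arguments double_supports {G} G2.
Arguments triple_supports {G} G2.

(** * Union bound and measurability *)

Lemma probability_bigsetU_le (d : measure_display) (T : measurableType d) (R : realType)
    (P : probability T R) (I : Type) (s : seq I) (Q : pred I) (F : I -> set T) :
  (forall i, measurable (F i)) ->
  (P (\big[setU/set0]_(i <- s | Q i) F i) <= \sum_(i <- s | Q i) P (F i))%E.
Proof.
move=> mF; elim: s => [|i s IH]; first by rewrite !big_nil measure0.
rewrite !big_cons; case: ifP => // _.
by apply: le_trans (measureU2 _ _ _) (leeD2l _ IH) => //; apply: bigsetU_measurable.
Qed.

(** The event is a finite union, over the outcome vectors satisfying [Q], of finite intersections of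
    events that fix one variable. *)
Lemma measurable_finite_RVs (d : measure_display) (T : measurableType d) (R : realType)
    (P : probability T R) (I : finType) (X : I -> {RV P >-> bool})
    (Q : (I -> bool) -> Prop) :
  measurable [set w | Q (fun i => X i w)]%classic.
Proof.
have -> : [set w | Q (fun i => X i w)]%classic =
    (\bigcup_(f in [set f : {ffun I -> bool} | Q f])
       \bigcap_(i in [set: I]) (X i @^-1` [set f i]))%classic.
  apply/seteqP; split => [w Qw|w [f /= Qf fw]] /=.
    exists [ffun i => X i w] => /=; last by move=> i _ /=; rewrite ffunE.
    by congr (Q _): Qw; apply/funext => i; rewrite ffunE.
  by congr (Q _): Qf; apply/funext => i; rewrite (fw i Logic.I).
apply: fin_bigcup_measurable; first exact: finite_finset.
move=> f _; apply: fin_bigcap_measurable; first exact: finite_finset.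
by move=> i _; apply: measurable_funPTI.
Qed.

(** * The probability estimate *)

Theorem theorem9p5 (R : realType) (G : finZmodType) (q : nat)
    (hq : #|G| = q) (h3 : ~~ (3 %| q)%N)
    (G2 : {set G}) (hG2 : half_set G2)
    (rho : R)
    (hrho1 : 6 / 5 * q%:R^-1 < rho)
    (hrho2 : rho < q%:R `^ (- (2 / 3)))
    (d : measure_display) (Omega : measurableType d) (P : probability Omega R)
    (xi : G -> {RV P >-> bool})
    (hindep : independent_RVs (invol_set G :|: G2)%SET xi)
    (hxi : forall y : G, y \in (invol_set G :|: G2)%SET ->
       P [set w | xi y w = true]%classic = rho%:E) :
  ((1 - q%:R ^+ 2 * rho ^+ 3)%:E <
   P [set w | (barDelta (standard_set_of G2 (fun y => xi y w)) <= 2)%N]%classic)%E.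
Proof.
subst q; set good := [set w | _]%classic.
have mgood : measurable good.
  exact: (@measurable_finite_RVs _ _ _ P _ xi
    (fun e => (barDelta (standard_set_of G2 e) <= 2)%N)).
pose E (J : {set G}) := [set w | forall i, i \in J -> xi i w = true]%classic.
have mE J : measurable (E J).
  exact: (@measurable_finite_RVs _ _ _ P _ xi (fun e => forall i, i \in J -> e i = true)).
have PE J : J \in (double_supports G2 :|: triple_supports G2)%SET ->
    P (E J) = (rho ^+ #|J|)%:E.
  move=> /(supports_sub hG2) JD.
  rewrite (hindep J (fun=> [set true]%classic)) //.
  rewrite (eq_bigr (fun=> rho%:E)) => [|i iJ]; last first.
    by apply: hxi; apply: (fintype.subsetP JD).
  by rewrite prodEFin prodr_const.
have bad_sub : (~` good `<=` \big[setU/set0]_(J in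
    (double_supports G2 :|: triple_supports G2)%SET) E J)%classic.
  move=> w /= /negP; rewrite -ltnNge => /(barDelta_gt2_support hG2 h3) [J JD Je].
  by rewrite -bigcup_pred; exists J => //= i /Je.
have bound : (P (~` good)%classic <=
    (#|double_supports G2|%:R * rho ^+ 2 + #|triple_supports G2|%:R * rho ^+ 3)%:E)%E.
  have : (P (~` good)%classic <= P (\big[setU/set0]_(J in
      (double_supports G2 :|: triple_supports G2)%SET) E J))%E.
    apply: le_measure bad_sub; rewrite inE; first exact: measurableC.
    exact: bigsetU_measurable.
  move=> /le_trans; apply.
  apply: le_trans (probability_bigsetU_le _ _ _ _ _ _ _ _ mE) _.
  (* The sizes 2 and 3 separate the two families, so the sum over their union splits. *)
  have dis : [disjoint double_supports G2 & triple_supports G2].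
    rewrite finset.disjoints_subset; apply/fintype.subsetP => J.
    by rewrite !inE => /andP[_ /eqP ->]; rewrite andbF.
  rewrite (eq_bigl [in [predU double_supports G2 & triple_supports G2]]);
    last by move=> J; rewrite !inE.
  rewrite bigU //=.
  rewrite (eq_bigr (fun=> (rho ^+ 2)%:E)) => [|J JD]; last first.
    by rewrite PE ?finset.in_setU ?JD //; move: JD; rewrite inE => /andP[_ /eqP ->].
  rewrite [X in (_ + X <= _)%E](eq_bigr (fun=> (rho ^+ 3)%:E)) => [|J JD]; last first.
    by rewrite PE ?finset.in_setU ?JD ?orbT //; move: JD; rewrite inE => /andP[_ /eqP ->].
  by rewrite !sumEFin !sumr_const -EFinD !mulr_natl.
have q0 : 0 < #|G|%:R :> R by rewrite ltr0n; apply/card_gt0P; exists 0.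
have r0 : 0 < rho by apply: lt_trans hrho1; rewrite mulr_gt0 ?invr_gt0 //; lra.
have qr : 6 / 5 < #|G|%:R * rho.
  by rewrite [_ * rho]mulrC -ltr_pdivrMr.
have num : #|double_supports G2|%:R * rho ^+ 2 + #|triple_supports G2|%:R * rho ^+ 3
    < #|G|%:R ^+ 2 * rho ^+ 3.
  have := card_double_supports hG2; rewrite -(ler_nat R) natrM => D2.
  have := @card_triple_supports G G2; rewrite -(ler_nat R) natrM natrX => T2.
  have r20 : 0 < rho ^+ 2 by rewrite exprn_gt0.
  have r30 : 0 < rho ^+ 3 by rewrite exprn_gt0.
  have H1 := ler_wpM2r (ltW r20) D2.
  have H2 := ler_wpM2r (ltW r30) T2.
  (* This says [q rho^2 < (5/6) q^2 rho^3]; half of it plus the triple term is at most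
     [(11/12) q^2 rho^3], and positivity of [q rho^2] makes the final inequality strict. *)
  have : 0 < (#|G|%:R * rho ^+ 2) * (#|G|%:R * rho - 6 / 5).
    by rewrite mulr_gt0 ?mulr_gt0 // subr_gt0.
  rewrite (_ : _ * (_ - _) = #|G|%:R ^+ 2 * rho ^+ 3 - 6 / 5 * (#|G|%:R * rho ^+ 2)); last first.
    by rewrite !exprS expr0; lra.
  have := mulr_gt0 q0 r20.
  lra.
have := probability_setC P (measurableC mgood); rewrite setCK => ->.
(* Finiteness turns the extended-real inequality into one between real numbers. *)
have : P (~` good)%classic \is a fin_num by apply: fin_num_measure; apply: measurableC.
move: bound; case: (P _) => [p||] //; rewrite lee_fin => pb _.
by rewrite -EFinB lte_fin ltrD2l ltrN2; apply: le_lt_trans num.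
Qed.
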